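(* Let $T \in \mathbb{Z}[z]$ be a polynomial of degree $m \geq 4$ with simple roots, none of which lies in $\{1,-1\}$, and suppose that $T$ is either a cyclotomic polynomial or a Salem polynomial. Then there exists a monic expansive polynomial $P \in \mathbb{Z}[z]$ of degree $m$ such that $$(z+1)\,T(z) = z\,P(z) + P^{*}(z).$$
   Context: For a polynomial $P$ of degree $n$, its reciprocal polynomial is $P^{*}(z) = z^{n} P(1/z)$. $P$ is called reciprocal if $P^*=P$. An expansive polynomial is a polynomial with coefficients in a real subfield of $\mathbb{C}$, of degree $\geq 1$, all of whose complex roots have modulus strictly greater than $1$. ''Cyclotomic polynomial'' means (non-standardly) a monic polynomial with integer coefficients having all its roots on the unit circle, i.e. a product of $n$-th cyclotomic polynomials $\Phi_n$ for various values of $n$. A Salem polynomial is a monic reciprocal polynomial with integer coefficients having exactly one zero (of multiplicity $1$) of modulus $>1$, this zero being a real number $>1$, and having at least one zero on the unit circle. *)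

(* Defs.v *)
From HB Require Import structures.
From mathcomp Require Import all_boot all_order all_algebra.
From mathcomp Require Import reals.
From mathcomp Require Export complex.

Set Implicit Arguments.
Unset Strict Implicit.
Unset Printing Implicit Defensive.

Import Order.TTheory GRing.Theory Num.Theory.
Local Open Scope ring_scope.
Local Open Scope complex_scope.

(* P^*(z) = z^n P(1/z) with n = deg P (the actual degree of P), obtained by
   reversing the coefficients of P; see reciprocalE. *)
Definition reciprocal (A : nzRingType) (p : {poly A}) : {poly A} :=
  \poly_(i < size p) p`_((size p).-1 - i).

Lemma reciprocalE (F : fieldType) (p : {poly F}) (z : F) :
  z != 0 -> (reciprocal p).[z] = z ^+ (size p).-1 * p.[z^-1].
Proof.
move=> z0; rewrite /reciprocal horner_poly horner_coef mulr_sumr.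
rewrite (reindex_inj rev_ord_inj) /=; apply: eq_bigr => i _.
have le_i : (i <= (size p).-1)%N by case: (size p) i => [[]|n i] //=; rewrite -ltnS.
have -> : (size p - i.+1 = (size p).-1 - i)%N by rewrite subnS predn_sub.
rewrite subKn // mulrCA; congr (_ * _).
by rewrite -{2}(subnK le_i) exprD exprVn mulfK // expf_neq0.
Qed.

(* [reciprocal] commutes with the change of coefficients from Z to C, so that
   reciprocalE also characterizes it on integer polynomials. *)
Lemma map_reciprocal (F : numDomainType) (p : {poly int}) :
  map_poly (intr : int -> F) (reciprocal p) = reciprocal (map_poly intr p).
Proof.
have sz : size (map_poly (intr : int -> F) p) = size p.
  by apply: size_map_inj_poly => //; apply: intr_inj.
apply/polyP => i; rewrite /reciprocal sz coef_map 2!coef_poly.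
by case: ifP => _ /=; rewrite ?coef_map.
Qed.

Definition is_reciprocal (A : nzRingType) (p : {poly A}) : Prop :=
  reciprocal p = p.

(* The image of an integer polynomial in C[z], where C = R[i]. *)
Definition polyZC (R : realType) (p : {poly int}) : {poly R[i]} :=
  map_poly intr p.

(* The coefficients lie in some subfield of the real numbers iff all of them
   are real. *)
Definition expansive (R : realType) (p : {poly R[i]}) : Prop :=
  [/\ p \is a polyOver Num.real, (1 < size p)%N &
      forall z : R[i], root p z -> 1 < `|z|].

(* Possibly a product of several of the usual cyclotomic polynomials, with
   repetitions allowed. *)
Definition cyclotomic (R : realType) (p : {poly int}) : Prop :=
  p \is monic /\ forall z : R[i], root (polyZC R p) z -> `|z| = 1.

Definition salem (R : realType) (p : {poly int}) : Prop :=
  [/\ p \is monic,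
      is_reciprocal p,
      exists tau : R,
        [/\ 1 < tau,
            root (polyZC R p) tau%:C,
            mup tau%:C (polyZC R p) = 1%N &
            forall z : R[i], root (polyZC R p) z -> 1 < `|z| -> z = tau%:C] &
      exists z : R[i], root (polyZC R p) z /\ `|z| = 1].

Definition simple_roots (F : fieldType) (p : {poly F}) : Prop :=
  forall z : F, root p z -> mup z p = 1%N.

(* Main.v *)
Require Import Defs.
From HB Require Import structures.
From mathcomp Require Import all_boot all_order all_algebra.
From mathcomp Require Import reals.
From mathcomp Require Import zify ring lra.

(**
Write x = z + 1/z. A reciprocal polynomial of even degree 2n is z^n p(x) for
some p with deg p <= n ([symmetrize n p] below). Since T has no root at 1 or
-1, it is reciprocal of even degree 2(k+1), so T = z^(k+1) t(x) with t monic
over Z ([trace_polynomial]). For every integer polynomial v of degree at most k,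
put W = z^k v(x); then P = T + (z-1) W is monic and satisfies
(z+1) T = z P + P^* ([completion]). So the only issue is to choose v such that
P has no zero in the closed unit disc.

The roots of t are simple, and real: the pairs of roots of T on the unit circle
give points of (-2,2), and a Salem number tau0 gives tau = tau0 + 1/tau0 > 2.
For x0 in [-2,2] let D_x0 = z^2 - x0 z + 1 = z (x - x0), which has its zeros on
the circle. The function (1 - z^2)/D_x0 is half a sum of two Poisson-Herglotz
kernels (1 + wz)/(1 - wz) with |w| = 1, so its real part is nonnegative on the
disc ([Re_kernel_ge0]). Therefore a function h + sum_i b_i (1 - z^2)/D_xi with
all b_i > 0 and Re h > 0 has no zero in the disc; clearing denominators and
treating the zeros of the D_xi separately gives [disc_nonvanishing].

- Cyclotomic case. Let xs be the roots of t and let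
  2v = - sum_i b_i prod_(j <> i) (x - x_j). Then, up to the factor prod_i D_xi,
  2(1+z)P is 2(1+z) + sum_i b_i (1 - z^2)/D_xi.
- Salem case. Let t = (x - tau) s, let xs consist of -2 and the roots of s, and
  let 2v = (2 + tau) s + sum_i b_i prod_(j <> i) (x - x_j). Because
  2 D_tau + (z-1)(2 + tau) = (z+1)(2z - tau) and D_(-2) = (z+1)^2, up to the
  same kind of factor, -2(1+z)P is (tau - 2z) + sum_i b_i (1 - z^2)/D_xi,
  and Re (tau - 2z) > 0 on the disc because tau > 2.

At z = -1, where the factor 1+z is lost, P is evaluated directly.

It remains to find an integral v with positive b_i. By Lagrange interpolation
the b_i are determined by the values of v at the x_i, and b_i > 0 for all i is
an open condition on v which is stable under going to infinity in a suitable
direction: a large real solution can be rounded coefficientwise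
([integral_positive_interpolation]).
*)

Set Implicit Arguments.
Unset Strict Implicit.
Unset Printing Implicit Defensive.

Import Order.TTheory GRing.Theory Num.Theory.
Local Open Scope ring_scope.

(** * Reciprocal polynomials as polynomials in z + 1/z *)

(** Lets identities between polynomials be checked where 1/z makes sense. *)
Lemma horner_inj_neq0 (F : numFieldType) (p q : {poly F}) :
  (forall z, z != 0 -> p.[z] = q.[z]) -> p = q.
Proof.
move=> pq; apply/eqP; rewrite -subr_eq0; apply/eqP.
apply: (@roots_geq_poly_eq0 _ _ [seq i.+1%:R | i <- iota 0 (size (p - q))]).
- apply/allP => _ /mapP[i _ ->]; rewrite rootE !hornerE pq ?subrr //.
  by rewrite pnatr_eq0.
- rewrite map_inj_uniq ?iota_uniq // => i j /eqP.
  by rewrite eqr_nat => /eqP[].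
- by rewrite size_map size_iota.
Qed.

(** This is z^n p(z + 1/z) with the denominators cleared, so that it makes
sense over any ring and can be evaluated at 0. *)
Definition symmetrize (A : nzRingType) (n : nat) (p : {poly A}) : {poly A} :=
  \sum_(i < n.+1) p`_i *: (('X^2 + 1) ^+ i * 'X^(n - i)).

Lemma symmetrizeD (A : nzRingType) n (p q : {poly A}) :
  symmetrize n (p + q) = symmetrize n p + symmetrize n q.
Proof.
rewrite -big_split /=; apply: eq_bigr => i _.
by rewrite coefD scalerDl.
Qed.

Lemma symmetrizeN (A : nzRingType) n (p : {poly A}) :
  symmetrize n (- p) = - symmetrize n p.
Proof.
by rewrite -sumrN; apply: eq_bigr => i _; rewrite coefN scaleNr.
Qed.

Lemma symmetrizeZ (A : comNzRingType) n c (p : {poly A}) :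
  symmetrize n (c *: p) = c *: symmetrize n p.
Proof.
by rewrite scaler_sumr; apply: eq_bigr => i _; rewrite coefZ scalerA.
Qed.

Lemma symmetrize_sum (A : nzRingType) n (I : Type) (r : seq I)
    (F : I -> {poly A}) :
  symmetrize n (\sum_(i <- r) F i) = \sum_(i <- r) symmetrize n (F i).
Proof.
elim: r => [|i r IH]; last by rewrite !big_cons symmetrizeD IH.
by rewrite !big_nil /symmetrize big1 // => i _; rewrite coef0 scale0r.
Qed.

Lemma map_symmetrize (A B : nzRingType) (f : {rmorphism A -> B}) n
    (p : {poly A}) :
  map_poly f (symmetrize n p) = symmetrize n (map_poly f p).
Proof.
rewrite rmorph_sum; apply: eq_bigr => i _ /=.
by rewrite map_polyZ coef_map rmorphM !rmorphXn rmorphD rmorphXn rmorph1 /=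
  map_polyX.
Qed.

Lemma horner_symmetrize (F : fieldType) n (p : {poly F}) (z : F) :
  (size p <= n.+1)%N -> z != 0 ->
  (symmetrize n p).[z] = z ^+ n * p.[z + z^-1].
Proof.
move=> szp z0; rewrite (horner_coef_wide _ szp) horner_sum mulr_sumr.
apply: eq_bigr => i _; rewrite hornerZ mulrCA; congr (_ * _).
rewrite hornerM !horner_exp hornerD hornerXn hornerX hornerC.
have -> : z ^+ 2 + 1 = z * (z + z^-1) by rewrite mulrDr divff // expr2.
rewrite exprMn mulrAC -exprD addnC subnK //.
by rewrite -ltnS.
Qed.

Lemma symmetrizeS (A : nzRingType) n (p : {poly A}) :
  (size p <= n.+1)%N -> symmetrize n.+1 p = 'X * symmetrize n p.
Proof.
move=> szp; rewrite /symmetrize big_ord_recr /= nth_default // scale0r addr0.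
rewrite mulr_sumr; apply: eq_bigr => i _.
rewrite subSn -1?ltnS // (exprSr 'X (n - i)) mulrA scalerAl.
exact: commr_polyX.
Qed.

Lemma size_symmetrize (A : nzRingType) n (p : {poly A}) :
  (size p <= n.+1)%N -> (size (symmetrize n p) <= (n + size p))%N.
Proof.
move=> szp; apply: (leq_trans (size_sum _ _ _)); apply/bigmax_leqP => i _.
have [lti|gei] := ltnP i (size p); last by rewrite nth_default // scale0r size_poly0.
apply: (leq_trans (size_scale_leq _ _)).
apply: (leq_trans (size_polyMleq _ _)); rewrite size_polyXn.
have szq : (size (('X^2 + 1 : {poly A}) ^+ i) <= (2 * i).+1)%N.
  apply: leq_trans (size_poly_exp_leq _ _) _.
  rewrite ltnS leq_mul2r; apply/orP; right.
  by rewrite (_ : 'X^2 + 1 = 'X^2 + 1%:P) // size_XnaddC.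
have lein : (i <= n)%N by rewrite -ltnS.
move: szq lti lein; case: (size _) => [|k]; lia.
Qed.

(** Symmetry with respect to a formal degree [n], possibly larger than the
actual one, so that palindromes of a given degree form a module. *)
Definition palindrome (A : nzRingType) n (p : {poly A}) :=
  (size p <= n.+1)%N /\ forall i, (i <= n)%N -> p`_i = p`_(n - i).

Lemma horner0_symmetrize (A : comNzRingType) n (p : {poly A}) :
  (symmetrize n p).[0] = p`_n.
Proof.
rewrite /symmetrize big_ord_recr /= hornerD hornerZ subnn expr0 mulr1 horner_sum.
rewrite horner_exp hornerD hornerXn expr0n /= hornerC add0r expr1n mulr1.
rewrite big1 ?add0r // => i _.
by rewrite hornerZ hornerM hornerXn expr0n subn_eq0 leqNgt ltn_ord !mulr0.
Qed.

Lemma palindromeD (A : nzRingType) n (p q : {poly A}) :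
  palindrome n p -> palindrome n q -> palindrome n (p + q).
Proof.
move=> [szp pp] [szq pq]; split.
  by apply: leq_trans (size_polyD _ _) _; rewrite geq_max szp.
by move=> i lei; rewrite !coefD -pp // -pq.
Qed.

Lemma palindromeZ (A : nzRingType) n c (p : {poly A}) :
  palindrome n p -> palindrome n (c *: p).
Proof.
move=> [szp pp]; split; first exact: leq_trans (size_scale_leq _ _) _.
by move=> i lei; rewrite !coefZ -pp.
Qed.

Lemma palindrome_mulX2D1 (A : nzRingType) n (p : {poly A}) :
  palindrome n p -> palindrome n.+2 (('X^2 + 1) * p).
Proof.
move=> [szp pp]; split.
  apply: leq_trans (size_polyMleq _ _) _.
  by rewrite (_ : 'X^2 + 1 = 'X^2 + 1%:P) // size_XnaddC.
have p_out i : (n < i)%N -> p`_i = 0.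
  by move=> lti; rewrite nth_default // (leq_trans szp).
move=> i lei; rewrite mulrDl mul1r !coefD !coefXnM addrC.
congr (_ + _).
- have [lti|gei] := ltnP (n.+2 - i) 2; first by rewrite p_out //; lia.
  by rewrite pp; [congr (_ `_ _)|]; lia.
- have [lti|gei] := ltnP i 2; first by rewrite p_out //; lia.
  by rewrite pp; [congr (_ `_ _)|]; lia.
Qed.

Lemma palindromeX2D1n (A : nzRingType) n :
  palindrome n.*2 (('X^2 + 1 : {poly A}) ^+ n).
Proof.
elim: n => [|n IH].
  split=> [|i]; first by rewrite size_poly1.
  by rewrite leqn0 => /eqP ->.
by rewrite exprS; exact: palindrome_mulX2D1.
Qed.

(** Subtracting p(0) (z^2+1)^n kills both extreme coefficients of p; what is
left is z times a palindrome of degree smaller by 2. *)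
Lemma palindrome_symmetrize (A : comNzRingType) n (p : {poly A}) :
  palindrome n.*2 p ->
  exists2 t : {poly A}, (size t <= n.+1)%N & p = symmetrize n t.
Proof.
elim: n p => [|n IH] p palp.
  case: palp => szp _; exists p => //.
  by rewrite /symmetrize big_ord1 /= !expr0 mulr1 alg_polyC; exact: size1_polyC.
pose q := p - p`_0 *: ('X^2 + 1) ^+ n.+1.
have palq : palindrome n.+1.*2 q.
  apply: palindromeD => //; rewrite -scaleNr; apply: palindromeZ.
  exact: palindromeX2D1n.
have q0 : q`_0 = 0.
  rewrite -horner_coef0 hornerD hornerN hornerZ horner_exp hornerD hornerXn.
  by rewrite expr0n /= hornerC add0r expr1n mulr1 horner_coef0 subrr.
have qE : q = 'X * (\poly_(i < n.*2.+1) q`_i.+1).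
  apply/polyP => -[|i]; rewrite coefXM ?q0 //= coef_poly.
  case: ltnP => // lei; case: palq => szq pq.
  have [->|nei] := eqVneq i n.*2.+1; first by rewrite pq ?doubleS ?subnn.
  by rewrite nth_default // (leq_trans szq) // doubleS; lia.
have [|t szt qt] := IH (\poly_(i < n.*2.+1) q`_i.+1).
  split=> [|i lei]; first exact: size_poly.
  rewrite !coef_poly !ltnS lei leq_subr.
  case: palq => _ ->; last by rewrite doubleS; lia.
  by rewrite doubleS; congr (_ `_ _); lia.
exists (t + p`_0 *: 'X^(n.+1)).
  apply: leq_trans (size_polyD _ _) _; rewrite geq_max (leq_trans szt) //=.
  by apply: leq_trans (size_scale_leq _ _) _; rewrite size_polyXn.
rewrite symmetrizeD (symmetrizeS szt) -qt -qE symmetrizeZ.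
rewrite [symmetrize _ ('X^_)]big_ord_recr /= big1 => [|i _]; last first.
  by rewrite coefXn ltn_eqF ?scale0r.
by rewrite coefXn eqxx scale1r add0r subnn expr0 mulr1 subrK.
Qed.

(** * Lagrange interpolation with positive weights and integral coefficients *)

(** The Lagrange basis for the nodes [xs], up to normalization. *)
Definition prod_but (A : nzRingType) (xs : seq A) (x : A) : {poly A} :=
  \prod_(y <- xs | y != x) ('X - y%:P).

Lemma size_prod_but (A : idomainType) (xs : seq A) (x : A) :
  uniq xs -> x \in xs -> size (prod_but xs x) = size xs.
Proof.
move=> uxs xxs; rewrite /prod_but -big_filter size_prod_XsubC.
rewrite -rem_filter // size_rem // prednK //.
by case: (xs) xxs.
Qed.

Lemma horner_prod_but_neq (A : idomainType) (xs : seq A) (x y : A) :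
  y \in xs -> y != x -> (prod_but xs x).[y] = 0.
Proof.
move=> yxs yx; rewrite horner_prod; apply/eqP.
rewrite prodf_seq_eq0; apply/hasP; exists y => //.
by rewrite yx !hornerE subrr eqxx.
Qed.

Lemma horner_prod_but_eq (A : idomainType) (xs : seq A) (x : A) :
  (prod_but xs x).[x] != 0.
Proof.
rewrite horner_prod prodf_seq_neq0; apply/allP => y _ /=.
by apply/implyP => yx; rewrite !hornerE subr_eq0 eq_sym.
Qed.

Lemma horner_sum_prod_but (A : idomainType) (xs : seq A) (b : A -> A) (x : A) :
  uniq xs -> x \in xs ->
  (\sum_(y <- xs) b y *: prod_but xs y).[x] = b x * (prod_but xs x).[x].
Proof.
move=> uxs xxs; rewrite horner_sum (bigD1_seq x) //= hornerZ big1 ?addr0 //.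
by move=> y yx; rewrite hornerZ horner_prod_but_neq ?mulr0 // eq_sym.
Qed.

Lemma lagrange (F : fieldType) (xs : seq F) (p : {poly F}) :
  uniq xs -> (size p <= size xs)%N ->
  p = \sum_(x <- xs) (p.[x] / (prod_but xs x).[x]) *: prod_but xs x.
Proof.
move=> uxs szp; apply/eqP; rewrite -subr_eq0; apply/eqP.
apply: (@roots_geq_poly_eq0 _ _ xs) => //.
  apply/allP => x xxs; rewrite rootE hornerD hornerN.
  rewrite (horner_sum_prod_but (fun x => p.[x] / (prod_but xs x).[x])) //.
  by rewrite divfK ?subrr // horner_prod_but_eq.
apply: leq_trans (size_polyD _ _) _; rewrite size_polyN geq_max szp /=.
rewrite big_seq; apply: leq_trans (size_sum _ _ _) _.
apply/bigmax_leqP_seq => x xxs _.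
by apply: leq_trans (size_scale_leq _ _) _; rewrite size_prod_but.
Qed.

(** The bound depends on [n] and x only, not on the size of the coefficients
of [p]; this is what makes rounding harmless after scaling up. *)
Lemma round_poly (R : realType) (n : nat) (p : {poly R}) :
  (size p <= n)%N ->
  exists2 q : {poly int}, (size q <= n)%N &
    forall x, `|(map_poly intr q).[x] - p.[x]| <= \sum_(i < n) `|x| ^+ i.
Proof.
move=> szp; exists (\poly_(i < n) Num.floor p`_i); first exact: size_poly.
move=> x; rewrite (@horner_coef_wide _ n); last first.
  by apply: leq_trans (size_poly _ _) _; exact: size_poly.
rewrite (horner_coef_wide _ szp) -sumrB.
apply: le_trans (ler_norm_sum _ _ _) _; apply: ler_sum => i _.
rewrite -mulrBl normrM normrX -[leRHS]mul1r ler_wpM2r ?exprn_ge0 //.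
rewrite coef_map coef_poly ltn_ord /=.
have /andP[h1 h2] := floor_itv p`_i.
rewrite distrC ger0_norm ?subr_ge0 // lerBlDl.
by move: h2; rewrite intrD => /ltW.
Qed.

(** With w the sum of the [prod_but xs x], the real polynomial N w has all its
coordinates equal to N in the Lagrange basis. Rounding N w and adding [e]
change the coordinates by amounts bounded independently of N, so they stay
positive when N is large. *)
Lemma integral_positive_interpolation (R : realType) (xs : seq R)
    (e : {poly R}) :
  uniq xs -> (size e <= size xs)%N ->
  exists v : {poly int}, exists b : R -> R,
    [/\ (size v <= size xs)%N,
        forall x, x \in xs -> 0 < b x &
        2 *: map_poly intr v + e = \sum_(x <- xs) b x *: prod_but xs x].
Proof.
move=> uxs sze; pose r := prod_but xs.
pose w := \sum_(x <- xs) 1 *: r x.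
have szw : (size w <= size xs)%N.
  rewrite /w big_seq; apply: leq_trans (size_sum _ _ _) _.
  apply/bigmax_leqP_seq => x xxs _.
  by apply: leq_trans (size_scale_leq _ _) _; rewrite size_prod_but.
have wE x : x \in xs -> w.[x] = (r x).[x].
  by move=> xxs; rewrite (horner_sum_prod_but (fun=> 1)) ?mul1r.
pose K (x : R) : R := \sum_(i < size xs) `|x| ^+ i.
(* A bound for the change of the coordinate at x, caused by
   rounding and by [e]. *)
pose c (x : R) : R := (2 * K x + `|e.[x]|) / `|(r x).[x]|.
have K0 x : 0 <= K x by apply: sumr_ge0 => i _; rewrite exprn_ge0.
have c0 x : 0 <= c x.
  by rewrite divr_ge0 ?addr_ge0 ?mulr_ge0.
pose N := 1 + \sum_(x <- xs) c x.
have cN x : x \in xs -> c x < N.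
  move=> xxs; rewrite /N (bigD1_seq x) //= addrCA ltrDl.
  by rewrite ltr_pwDl // sumr_ge0.
have [|v szv vN] := @round_poly R (size xs) (N *: w).
  exact: leq_trans (size_scale_leq _ _) _.
pose q : {poly R} := 2 *: map_poly intr v + e.
exists v, (fun x => q.[x] / (r x).[x]); split=> //; last first.
  apply: lagrange => //; apply: leq_trans (size_polyD _ _) _.
  rewrite geq_max sze andbT; apply: leq_trans (size_scale_leq _ _) _.
  exact: leq_trans (size_poly _ _) _.
move=> x xxs.
have rx0 : (r x).[x] != 0 by exact: horner_prod_but_eq.
have := vN x; rewrite hornerZ wE // -/(K x) => vx.
have := cN x xxs; rewrite /c ltr_pdivrMr ?normr_gt0 // => cx.
have -> : q.[x] / (r x).[x] = 2 * N +
    (2 * ((map_poly intr v).[x] - N * (r x).[x]) + e.[x]) / (r x).[x].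
  by rewrite /q hornerD hornerZ; field.
set y := (X in _ + X / _).
have : `|y| <= 2 * K x + `|e.[x]|.
  apply: le_trans (ler_normD _ _) _; rewrite lerD2r normrM ger0_norm //.
  by rewrite ler_wpM2l.
move=> yx.
have : `|y / (r x).[x]| < N.
  by rewrite normf_div ltr_pdivrMr ?normr_gt0 //; apply: le_lt_trans cx.
have : 0 < N by apply: le_lt_trans (cN x xxs).
rewrite ltr_norml => N0 /andP[h _]; lra.
Qed.

(** * Nonvanishing in the unit disc *)

(** This is z (z + 1/z - x), whose zeros lie on the unit circle for real x in
[-2,2]. *)
Definition recip_quad (A : nzRingType) (x : A) : {poly A} :=
  'X^2 - x *: 'X + 1.

Section Disc.
Variable C : numClosedFieldType.
Implicit Types x z : C.

(** The numerator of the real part is, up to a positive factor,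
(1 - |z|^2) ((2 + x) |1 - z|^2 + (2 - x) |1 + z|^2). *)
Lemma Re_kernel_ge0 x z : -2 <= x -> x <= 2 -> `|z| <= 1 ->
  0 <= 'Re ((1 - z ^+ 2) / (recip_quad x).[z]).
Proof.
move=> xm2 x2 z1.
have xr : x^* = x.
  by apply/CrealP; rewrite -(ler_real xm2) realN realn.
have [->|D0] := eqVneq (recip_quad x).[z] 0; first by rewrite invr0 mulr0 raddf0.
have NcE : (1 - z ^+ 2)^* = 1 - z^* ^+ 2 by rewrite rmorphB rmorph1 rmorphXn.
rewrite ReE divr_ge0 // fmorph_div /= NcE.
have DE : (recip_quad x).[z] = z ^+ 2 - x * z + 1 by rewrite /recip_quad !hornerE.
have DcE : (recip_quad x).[z]^* = z^* ^+ 2 - x * z^* + 1.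
  by rewrite DE rmorphD rmorphB rmorphXn rmorph1 (rmorphM _ x) /= xr.
have -> : (1 - z ^+ 2) / (recip_quad x).[z]
    + (1 - z^* ^+ 2) / (recip_quad x).[z]^* =
  (1 - z * z^*) * ((2 + x) * ((1 - z) * (1 - z)^* )
                 + (2 - x) * ((1 + z) * (1 + z)^* ))
    / 2 / ((recip_quad x).[z] * (recip_quad x).[z]^* ) .
  rewrite rmorphB rmorphD rmorph1 /=.
  have Dc0 : (recip_quad x).[z]^* != 0 by rewrite conjC_eq0.
  move: D0 Dc0; rewrite DcE DE => D0 Dc0; field.
  by rewrite D0 Dc0.
rewrite divr_ge0 // ?mul_conjC_ge0 //.
apply: divr_ge0 => //; apply: mulr_ge0.
  by rewrite subr_ge0 -normCK expr_le1.
rewrite addr_ge0 // mulr_ge0 ?mul_conjC_ge0 ?subr_ge0 //.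
by rewrite addrC -(opprK 2) subr_ge0.
Qed.

Lemma recip_quad_neq0 x y z :
  x != y -> (recip_quad x).[z] = 0 -> (recip_quad y).[z] != 0.
Proof.
rewrite /recip_quad !hornerE => xy Dx.
have z0 : z != 0.
  apply/eqP => z0; move: Dx; rewrite z0 expr0n mulr0 subr0 add0r.
  by move/eqP; rewrite oner_eq0.
have -> : z ^+ 2 - y * z + 1 = (x - y) * z.
  by rewrite -[RHS](addr0) -Dx; ring.
by rewrite mulf_neq0 // subr_eq0.
Qed.

(** Away from the zeros of the quadratic factors, divide by their product and
take real parts. At a zero of one of them all but one of the terms vanish,
because distinct [recip_quad]s are coprime; the zeros of 1 - z^2 are avoided
since x <> 2 and z <> -1. *)
Lemma disc_nonvanishing (xs : seq C) (b : C -> C) (h z : C) :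
  uniq xs -> (forall x, x \in xs -> -2 <= x < 2) ->
  (forall x, x \in xs -> 0 < b x) ->
  `|z| <= 1 -> z != -1 -> 0 < 'Re h ->
  h * \prod_(x <- xs) (recip_quad x).[z] + (1 - z ^+ 2) *
    \sum_(x <- xs) b x * \prod_(y <- xs | y != x) (recip_quad y).[z] != 0.
Proof.
move=> uxs xs2 b0 z1 zN1 h0.
pose D x := (recip_quad x).[z].
have [/hasP[x xxs /eqP Dx0]|/hasPn Dxs] := boolP (has (fun x => D x == 0) xs).
- have -> : \prod_(y <- xs) D y = 0.
    by apply/eqP; rewrite prodf_seq_eq0; apply/hasP; exists x; rewrite ?Dx0 /=.
  have -> : \sum_(w <- xs) b w * \prod_(y <- xs | y != w) D y
      = b x * \prod_(y <- xs | y != x) D y.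
    rewrite (bigD1_seq x) //= [X in _ + X]big1 ?addr0 // => w wx.
    apply/eqP; rewrite mulf_eq0; apply/orP; right.
    rewrite prodf_seq_eq0; apply/hasP; exists x => //.
    by rewrite eq_sym wx Dx0 eqxx.
  rewrite mulr0 add0r.
  rewrite mulf_neq0 //; last first.
    apply: mulf_neq0; first by rewrite gt_eqF // b0.
    rewrite prodf_seq_neq0; apply/allP => y yxs /=.
    by apply/implyP => yx; apply: (recip_quad_neq0 _ Dx0); rewrite eq_sym.
  rewrite subr_eq0 eq_sym sqrf_eq1 negb_or zN1 andbT.
  apply/eqP => z_1; move: Dx0; rewrite /D /recip_quad !hornerE z_1 expr1n mulr1.
  move=> /eqP; rewrite addrAC subr_eq0 => /eqP x2.
  by have /andP[_] := xs2 x xxs; rewrite -x2 -[1 + 1]/(2%:R) ltxx.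
- pose p := \prod_(x <- xs) D x.
  have p0 : p != 0 by rewrite prodf_seq_neq0; apply/allP => x /Dxs.
  rewrite -/p.
  have -> : \sum_(x <- xs) b x * \prod_(y <- xs | y != x) D y
      = p * \sum_(x <- xs) b x / D x.
    rewrite mulr_sumr big_seq [RHS]big_seq; apply: eq_bigr => x xxs.
    by rewrite /p [X in X * (_ / _)](bigD1_seq x) //=; field; exact: Dxs.
  rewrite mulrCA [h * p]mulrC -mulrDr mulf_neq0 //.
  apply/eqP => hE; suff : 0 < 'Re (0 : C) by rewrite raddf0 ltxx.
  rewrite -[X in 'Re X]hE raddfD ltr_pwDl // mulr_sumr raddf_sum big_seq.
  apply: sumr_ge0 => x xxs; rewrite mulrCA /= mulrC.
  have bx : b x \is Num.real by rewrite ger0_real ?ltW ?b0.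
  have /andP[x_ge x_lt] := xs2 x xxs.
  have := Re_kernel_ge0 x_ge (ltW x_lt) z1; rewrite -/(D x) => Re0.
  by rewrite ReMr // mulr_ge0 // ltW ?b0.
Qed.

End Disc.

Lemma symmetrize_prod_XsubC (F : numFieldType) (xs : seq F) :
  symmetrize (size xs) (\prod_(x <- xs) ('X - x%:P))
  = \prod_(x <- xs) recip_quad x.
Proof.
apply: horner_inj_neq0 => z z0; rewrite horner_symmetrize ?size_prod_XsubC //.
rewrite !horner_prod; elim: xs => [|x xs IH]; first by rewrite !big_nil expr0 mul1r.
rewrite !big_cons -IH /= exprS mulrACA; congr (_ * _).
rewrite /recip_quad hornerXsubC !hornerE mulrBr mulrDr divff // -expr2.
by rewrite addrAC [z * x]mulrC.
Qed.

Lemma symmetrize_prod_but (F : numFieldType) n (xs : seq F) x :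
  uniq xs -> x \in xs -> size xs = n.+1 ->
  symmetrize n (prod_but xs x) = \prod_(y <- xs | y != x) recip_quad y.
Proof.
move=> uxs xxs szxs; rewrite -big_filter -symmetrize_prod_XsubC big_filter.
by rewrite -rem_filter // size_rem // szxs.
Qed.

(** * The trace polynomial of T *)

Lemma palindrome_of_reciprocal (A : nzRingType) n (p : {poly A}) :
  size p = n.+1 -> is_reciprocal p -> palindrome n p.
Proof.
move=> szp rp; split=> [|i lei]; first by rewrite szp.
by rewrite -[in LHS]rp coef_poly szp ltnS lei.
Qed.

Section ClosedField.
Variable C : numClosedFieldType.
Implicit Types x z : C.
Local Notation toC := (map_poly (intr : int -> C)).

Lemma map_intr_inj : injective toC.
Proof. by apply: map_inj_poly => //; exact: intr_inj. Qed.

Lemma size_map_intr (p : {poly int}) : size (toC p) = size p.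
Proof. by apply: size_map_inj_poly => //; exact: intr_inj. Qed.

Lemma horner_toC_conj (p : {poly int}) z : (toC p).[z^*] = ((toC p).[z])^*.
Proof.
rewrite -horner_map -map_poly_comp; congr (_.[_]).
by apply: eq_map_poly => a /=; rewrite rmorph_int.
Qed.

(** Since 1/x is the conjugate of x for every root x, and p has real
coefficients, p^* = p(0) p; evaluation at 1 gives p(0) = 1. *)
Lemma reciprocal_of_unit_roots (p : {poly int}) :
  p \is monic -> (forall z, root (toC p) z -> `|z| = 1) -> (toC p).[1] != 0 ->
  is_reciprocal p.
Proof.
move=> monp unitp p1.
have [rs prs] := closed_field_poly_normal (toC p).
have lc1 : lead_coef (toC p) = 1.
  by rewrite lead_coef_map_inj //; [rewrite (monicP monp)|exact: intr_inj].
rewrite lc1 scale1r in prs.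
have unitrs x : x \in rs -> x * x^* = 1.
  by move=> xrs; rewrite -normCK unitp ?expr1n // prs root_prod_XsubC.
have rE z : z != 0 -> (reciprocal (toC p)).[z] = (toC p).[0] * (toC p).[z].
  move=> z0; rewrite reciprocalE // -[z in RHS]conjCK horner_toC_conj prs.
  rewrite size_prod_XsubC /= !horner_prod rmorph_prod -big_split /=.
  have -> : z ^+ size rs = \prod_(x <- rs) z.
    by rewrite big_tnth prodr_const card_ord.
  rewrite -big_split /= big_seq [RHS]big_seq.
  apply: eq_bigr => x /unitrs xx.
  rewrite !hornerXsubC rmorphB /= conjCK mulrBr divff // sub0r mulrBr mulNr.
  by rewrite mulNr opprK xx addrC mulrC.
have p0 : (toC p).[0] = 1.
  have := rE 1 (oner_neq0 _); rewrite reciprocalE ?oner_neq0 // invr1 expr1n.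
  by rewrite mul1r => p1E; apply: (mulIf p1); rewrite mul1r -p1E.
apply: map_intr_inj; rewrite map_reciprocal; apply: horner_inj_neq0 => z /rE ->.
by rewrite p0 mul1r.
Qed.

(** Otherwise evaluation of p^* = p at -1 would give - p(-1) = p(-1). *)
Lemma even_size_reciprocal (p : {poly int}) n :
  size p = n.+1 -> is_reciprocal p -> (toC p).[-1] != 0 -> ~~ odd n.
Proof.
move=> szp rp pN1; apply/negP => oddn.
have : (reciprocal (toC p)).[-1] = - (toC p).[-1].
  rewrite reciprocalE ?oppr_eq0 ?oner_neq0 // size_map_intr szp /= invrN invr1.
  by rewrite -signr_odd oddn mulN1r.
rewrite -map_reciprocal rp => /eqP; rewrite -addr_eq0 -mulr2n mulrn_eq0.
by rewrite (negPf pN1).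
Qed.

Lemma trace_polynomial (p : {poly int}) m :
  size p = m.+1 -> p \is monic -> is_reciprocal p -> (toC p).[-1] != 0 ->
  exists d, exists t : {poly int},
    [/\ m = d.*2, size t = d.+1, t \is monic & p = symmetrize d t].
Proof.
move=> szp monp rp pN1.
have m_even : m = m./2.*2 by rewrite even_halfK ?(even_size_reciprocal szp).
have [|t szt pt] := @palindrome_symmetrize _ m./2 p.
  by rewrite -m_even; exact: palindrome_of_reciprocal.
have t_lead : t`_(m./2) = 1.
  rewrite -horner0_symmetrize -pt horner_coef0.
  have [_ ->//] := palindrome_of_reciprocal szp rp.
  by move/monicP: monp; rewrite /lead_coef szp subn0.
exists m./2, t; have szt' : size t = (m./2).+1.
  apply/eqP; rewrite eqn_leq szt ltnNge; apply/negP => h.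
  by move: t_lead; rewrite nth_default.
by split=> //; rewrite monicE /lead_coef szt' t_lead.
Qed.

Lemma addr_invr_surj x : exists2 z, z != 0 & x = z + z^-1.
Proof.
pose z := (x + sqrtC (x ^+ 2 - 4)) / 2.
have zE : z * (x - z) = 1.
  have -> : z * (x - z) = (x ^+ 2 - sqrtC (x ^+ 2 - 4) ^+ 2) / 4.
    by rewrite /z; field.
  by rewrite sqrtCK; field.
have z0 : z != 0.
  by apply/eqP => z0; move: zE; rewrite z0 mul0r => /esym/eqP; rewrite oner_eq0.
by exists z => //; apply: (mulfI z0); rewrite mulrDr divff // -zE; ring.
Qed.

Lemma horner_recip_quad x z : (recip_quad x).[z] = z ^+ 2 - x * z + 1.
Proof. by rewrite /recip_quad !hornerE. Qed.

Lemma root_symmetrize n (p : {poly C}) x : (size p <= n.+1)%N -> root p x ->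
  exists2 z, root (symmetrize n p) z & x = z + z^-1.
Proof.
move=> szp /eqP px; have [z z0 xz] := addr_invr_surj x.
by exists z => //; rewrite rootE horner_symmetrize // -xz px mulr0.
Qed.

(** On the circle 2 - (z + 1/z) = |1 - z|^2 and 2 + (z + 1/z) = |1 + z|^2. *)
Lemma trace_unit_circle z : `|z| = 1 -> z != 1 -> z != -1 ->
  -2 < z + z^-1 < 2.
Proof.
move=> z1 zn1 znN1.
have zz : z * z^* = 1 by rewrite -normCK z1 expr1n.
have -> : z^-1 = z^*.
  by rewrite invC_norm z1 expr1n invr1 mul1r.
rewrite -subr_gt0 -[X in _ && X]subr_gt0; apply/andP; split.
- have -> : z + z^* - -2 = (1 + z) * (1 + z)^*.
    by rewrite rmorphD rmorph1 mulrDl mul1r mulrDr mulr1 zz; ring.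
  by rewrite mul_conjC_gt0 addrC addr_eq0.
- have -> : 2 - (z + z^* ) = (1 - z) * (1 - z)^*.
    by rewrite rmorphB rmorph1 mulrBl mul1r mulrBr mulr1 zz; ring.
  by rewrite mul_conjC_gt0 subr_eq0 eq_sym.
Qed.

(** A repeated trace x makes the square of [recip_quad x] divide the product,
so that each zero of [recip_quad x] is a multiple root. *)
Lemma uniq_trace_roots (rs : seq C) :
  simple_roots (symmetrize (size rs) (\prod_(x <- rs) ('X - x%:P))) -> uniq rs.
Proof.
rewrite symmetrize_prod_XsubC => simp; apply: count_mem_uniq => x.
have [xrs|/count_memPn->//] := boolP (x \in rs).
have [xrs'|/count_memPn xrs'] := boolP (x \in rem x rs); last first.
  by rewrite (permP (perm_to_rem xrs)) /= eqxx xrs'.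
have [z z0 xz] := addr_invr_surj x.
have rz : root (recip_quad x) z.
  by rewrite rootE horner_recip_quad xz; apply/eqP; field.
have : \prod_(x <- rs) recip_quad x =
    recip_quad x ^+ 2 * \prod_(x <- rem x (rem x rs)) recip_quad x.
  rewrite (perm_big _ (perm_to_rem xrs)) big_cons.
  by rewrite (perm_big _ (perm_to_rem xrs')) big_cons /= mulrA.
set q := \prod_(x <- rs) _ => qE.
have q0 : q != 0.
  rewrite prodf_seq_neq0; apply/allP => y _ /=; apply/eqP => /(congr1 (horner^~ 0)).
  by rewrite horner_recip_quad horner0 expr0n mulr0 subr0 add0r => /eqP; rewrite oner_eq0.
have dq : ('X - z%:P) ^+ 2 %| q.
  by rewrite qE dvdp_mulr // dvdp_exp2r // dvdp_XsubCl.
have rq : root q z by rewrite qE rootM expr2 rootM rz.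
by move: dq; rewrite -mup_geq // (simp _ rq).
Qed.

(** * Nonvanishing of the completed polynomials *)

Lemma addz_conj_le2 z : `|z| <= 1 -> z + z^* <= 2.
Proof.
move=> z1; have : 0 <= (1 - z) * (1 - z)^* + (1 - z * z^* ).
  by rewrite addr_ge0 ?mul_conjC_ge0 // subr_ge0 -normCK expr_le1.
have -> : (1 - z) * (1 - z)^* + (1 - z * z^* ) = 2 - (z + z^* ).
  by rewrite rmorphB rmorph1 /=; ring.
by rewrite subr_ge0.
Qed.

Lemma Re_1D_gt0 z : `|z| <= 1 -> z != -1 -> 0 < 'Re (1 + z).
Proof.
move=> z1 zN1; rewrite ReE divr_gt0 //.
have : 0 < (1 + z) * (1 + z)^* + (1 - z * z^* ).
  rewrite ltr_pwDl ?mul_conjC_gt0 1?addrC ?addr_eq0 //.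
  by rewrite addrC subr_ge0 -normCK expr_le1.
congr (0 < _); rewrite rmorphD rmorph1 /=; ring.
Qed.

Lemma Re_subZ2_gt0 t z : 2 < t -> `|z| <= 1 -> 0 < 'Re (t - 2 * z).
Proof.
move=> t2 z1; rewrite ReE divr_gt0 //.
have tr : t^* = t by rewrite geC0_conj // ltW // (lt_trans _ t2).
have -> : t - 2 * z + (t - 2 * z)^* = 2 * (t - (z + z^* )).
  by rewrite rmorphB rmorphM rmorph_nat /= tr; ring.
by rewrite mulr_gt0 // subr_gt0 (le_lt_trans _ t2) // addz_conj_le2.
Qed.

Lemma prod_recip_quadN1_ge0 (xs : seq C) (P : pred C) :
  (forall x, x \in xs -> -2 <= x) ->
  0 <= \prod_(x <- xs | P x) (recip_quad x).[-1].
Proof.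
move=> xs2; rewrite big_seq_cond; apply: prodr_ge0 => x /andP[xxs _].
rewrite horner_recip_quad sqrrN expr1n mulrN1 opprK.
by rewrite addrAC -(opprK (1 + 1)) addrC subr_ge0 xs2.
Qed.

Lemma prod_recip_quadN1_gt0 (xs : seq C) :
  (forall x, x \in xs -> -2 < x) ->
  0 < \prod_(x <- xs) (recip_quad x).[-1].
Proof.
move=> xs2; rewrite big_seq; apply: prodr_gt0 => x xxs.
rewrite horner_recip_quad sqrrN expr1n mulrN1 opprK.
by rewrite addrAC -(opprK (1 + 1)) addrC subr_gt0 xs2.
Qed.

(** For z <> -1, multiplication by 1 + z reduces this to [disc_nonvanishing]
with h = 2 (1 + z); at -1 every term is nonnegative and the first is positive. *)
Lemma cyclotomic_nonvanishing (xs : seq C) (b : C -> C) z :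
  uniq xs -> (forall x, x \in xs -> -2 < x < 2) ->
  (forall x, x \in xs -> 0 < b x) -> `|z| <= 1 ->
  2 * \prod_(x <- xs) (recip_quad x).[z] + (1 - z) *
    \sum_(x <- xs) b x * \prod_(y <- xs | y != x) (recip_quad y).[z] != 0.
Proof.
move=> uxs xs2 b0 z1.
have [->|zN1] := eqVneq z (-1).
  rewrite gt_eqF // ltr_pwDl //.
    by rewrite mulr_gt0 // prod_recip_quadN1_gt0 // => x /xs2 /andP[].
  rewrite opprK; apply: mulr_ge0; first by rewrite addr_ge0.
  rewrite big_seq; apply: sumr_ge0 => x xxs.
  apply: mulr_ge0; first by rewrite ltW // b0.
  by apply: prod_recip_quadN1_ge0 => y /xs2/andP[/ltW].
have h0 : 0 < 'Re (2 * (1 + z)).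
  by rewrite ReMl ?realn // mulr_gt0 // Re_1D_gt0.
have xs2' x : x \in xs -> -2 <= x < 2 by move=> /xs2 /andP[/ltW -> ->].
apply/eqP => eq0; have /eqP[] := disc_nonvanishing uxs xs2' b0 z1 zN1 h0.
set p := \prod_(x <- xs) _ in eq0 *; set s := \sum_(x <- xs) _ in eq0 *.
have -> : 2 * (1 + z) * p + (1 - z ^+ 2) * s = (1 + z) * (2 * p + (1 - z) * s).
  by ring.
by rewrite eq0 mulr0.
Qed.

(** For z <> -1, multiplication by 1 + z reduces this to [disc_nonvanishing]
with h = t - 2 z, because [recip_quad (-2)] is (1 + z)^2. At -1 the first term
vanishes, and in the sum the summand of index -2 is positive. *)
Lemma salem_nonvanishing (ys : seq C) (b : C -> C) t z :
  uniq (-2 :: ys) -> (forall x, x \in ys -> -2 < x < 2) ->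
  (forall x, x \in -2 :: ys -> 0 < b x) -> 2 < t -> `|z| <= 1 ->
  (1 + z) * (t - 2 * z) * \prod_(x <- ys) (recip_quad x).[z] + (1 - z) *
    \sum_(x <- -2 :: ys) b x *
      \prod_(y <- -2 :: ys | y != x) (recip_quad y).[z] != 0.
Proof.
move=> uxs ys2 b0 t2 z1.
have xs2 x : x \in -2 :: ys -> -2 <= x < 2.
  rewrite inE => /orP[/eqP->|/ys2/andP[/ltW->->//]].
  by rewrite lexx (lt_trans (_ : -2 < 0)) // oppr_lt0.
have [->|zN1] := eqVneq z (-1).
  rewrite subrr !mul0r add0r opprK.
  apply: lt0r_neq0; apply: mulr_gt0; first by rewrite addr_gt0.
  rewrite big_cons ltr_pwDl //.
    rewrite mulr_gt0 ?b0 ?mem_head // big_cons eqxx /=.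
    rewrite big_seq_cond (eq_bigl (fun y => y \in ys)) -?big_seq.
      by rewrite prod_recip_quadN1_gt0 // => x /ys2 /andP[].
    move=> y /=; have [yys|] := boolP (y \in ys) => //=.
    by have /andP[/gt_eqF -> _] := ys2 y yys.
  rewrite big_seq; apply: sumr_ge0 => x xys.
  rewrite mulr_ge0 //; first by rewrite ltW // b0 // inE xys orbT.
  by apply: prod_recip_quadN1_ge0 => y /xs2/andP[].
apply/eqP => eq0.
have /eqP[] := disc_nonvanishing uxs xs2 b0 z1 zN1 (Re_subZ2_gt0 t2 z1).
rewrite [X in _ * X + _ = _]big_cons horner_recip_quad.
set p := \prod_(x <- ys) _ in eq0 *; set s := \sum_(x <- _) _ in eq0 *.
have -> : (t - 2 * z) * ((z ^+ 2 - -2 * z + 1) * p) + (1 - z ^+ 2) * s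
   = (1 + z) * ((1 + z) * (t - 2 * z) * p + (1 - z) * s) by ring.
by rewrite eq0 mulr0.
Qed.

(** * Solving the functional equation *)

(** As z^(2k) W(1/z) = W(z) for W = [symmetrize k v], the term (z - 1) W of P
contributes - z (z - 1) W to P^*, which cancels its contribution to z P. *)
Lemma completion k (t v : {poly int}) (T := symmetrize k.+1 t)
    (P := T + ('X - 1) * symmetrize k v) :
  T \is monic -> size T = (k.+1).*2.+1 -> (size t <= k.+2)%N ->
  (size v <= k.+1)%N ->
  [/\ P \is monic, size P = (k.+1).*2.+1
    & ('X + 1) * T = 'X * P + reciprocal P].
Proof.
move=> monT szT szt szv.
have szW : (size (('X - 1) * symmetrize k v)%R < size T)%N.
  rewrite szT; apply: leq_ltn_trans (size_polyMleq _ _) _.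
  rewrite (_ : 'X - 1 = 'X - 1%:P) // size_XsubC add2n succnK.
  have := szv; have := size_symmetrize szv; move: (size (symmetrize k v)) (size v).
  by move=> i j; lia.
have szP : size P = (k.+1).*2.+1 by rewrite size_polyDl.
split=> //; first by rewrite monicE lead_coefDl // -monicE.
apply: map_intr_inj; rewrite !(rmorphD, rmorphM) rmorphN rmorph1 /= map_reciprocal.
rewrite map_polyX; apply: horner_inj_neq0 => z z0.
have zV0 : z^-1 != 0 by rewrite invr_eq0.
have szt' : (size (toC t) <= k.+2)%N by rewrite size_map_intr.
have szv' : (size (toC v) <= k.+1)%N by rewrite size_map_intr.
rewrite !hornerE reciprocalE // size_map_intr szP /= /P rmorphD rmorphM rmorphB /=.
rewrite rmorph1 map_polyX !hornerE !map_symmetrize !horner_symmetrize //.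
rewrite invrK [z^-1 + z]addrC -addnn exprD !exprS !exprVn.
move: (expf_neq0 k z0) (toC t).[_] (toC v).[_] => zk0 a c.
by field; rewrite z0 zk0.
Qed.

End ClosedField.

(** * Choice of the free parameter over the reals *)

Local Open Scope complex_scope.

Section Real.
Variable R : realType.
Local Notation toR := (map_poly (intr : int -> R)).
Local Notation toC := (map_poly (intr : int -> R[i])).
Local Notation ofR := (map_poly (real_complex R)).

Lemma ofR_toR (p : {poly int}) : ofR (toR p) = toC p.
Proof.
rewrite -map_poly_comp; apply: eq_map_poly => a /=.
exact: (rmorph_int (real_complex R)).
Qed.

Lemma ofR_prod_XsubC (xs : seq R) (P : pred R) :
  ofR (\prod_(x <- xs | P x) ('X - x%:P)) = \prod_(x <- xs | P x) ('X - (x%:C)%:P).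
Proof.
rewrite rmorph_prod; apply: eq_bigr => x _.
by rewrite rmorphB /= map_polyX map_polyC.
Qed.

Lemma real_rooted_factorization (t : {poly int}) n :
  t \is monic -> size t = n.+1 ->
  (forall x : R[i], root (toC t) x -> x \is Num.real) ->
  exists2 xs : seq R, size xs = n & toR t = \prod_(x <- xs) ('X - x%:P).
Proof.
move=> mont szt realt; have [rs trs] := closed_field_poly_normal (toC t).
have lc1 : lead_coef (toC t) = 1.
  by rewrite lead_coef_map_inj //; [rewrite (monicP mont)|exact: intr_inj].
rewrite lc1 scale1r in trs.
exists [seq complex.Re x | x <- rs].
  have := congr1 (fun p : {poly R[i]} => size p) trs.
  by rewrite size_map size_prod_XsubC size_map_intr szt => -[].
apply: (@map_inj_poly _ _ (real_complex R)) => //; first exact: complexI.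
rewrite ofR_toR ofR_prod_XsubC big_map trs big_seq [RHS]big_seq.
apply: eq_bigr => x xrs; rewrite RRe_real //.
by apply: realt; rewrite trs root_prod_XsubC.
Qed.

(** Goes from real nodes to complex ones: this turns the output of
[integral_positive_interpolation] into the sum of [disc_nonvanishing]. *)
Lemma symmetrize_sum_prod_but k (xs : seq R) (b : R -> R) :
  uniq xs -> size xs = k.+1 ->
  symmetrize k (ofR (\sum_(x <- xs) b x *: prod_but xs x)) =
  \sum_(x <- map (real_complex R) xs) (b (complex.Re x))%:C *:
    \prod_(y <- map (real_complex R) xs | y != x) recip_quad y.
Proof.
move=> uxs szxs; rewrite rmorph_sum /= symmetrize_sum big_map big_seq [RHS]big_seq.
apply: eq_bigr => x xxs; rewrite map_polyZ symmetrizeZ; congr (_ *: _).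
rewrite -(@symmetrize_prod_but _ k (map (real_complex R) xs)); last first.
- by rewrite size_map.
- by rewrite map_f.
- by rewrite map_inj_uniq //; exact: complexI.
rewrite ofR_prod_XsubC /prod_but big_map; congr (symmetrize k _).
by apply: eq_bigl => y; rewrite (inj_eq (@complexI R)).
Qed.

Lemma ltc_itv (x : R) : (-2 < x < 2) = (-2 < x%:C < 2).
Proof.
by rewrite -!ltcR rmorphN /= !(rmorph_nat (real_complex R)).
Qed.

(** With - 2 v a positive combination of the Lagrange basis for the roots xs,
2 P is the expression of [cyclotomic_nonvanishing]. *)
Lemma cyclotomic_completion k (t : {poly int}) (xs : seq R) :
  toR t = \prod_(x <- xs) ('X - x%:P) -> size xs = k.+1 -> uniq xs ->
  (forall x, x \in xs -> -2 < x < 2) ->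
  exists2 v : {poly int}, (size v <= k.+1)%N &
    forall z : R[i], `|z| <= 1 ->
      (toC (symmetrize k.+1 t + ('X - 1) * symmetrize k v)).[z] != 0.
Proof.
move=> tE szxs uxs xs2.
have [|v [b [szv b0 vE]]] := @integral_positive_interpolation R xs 0 uxs.
  by rewrite size_poly0.
exists (- v); first by rewrite size_polyN -szxs.
move=> z z1; pose cs := map (real_complex R) xs.
have cs2 c : c \in cs -> -2 < c < 2 by move=> /mapP[x /xs2 x2 ->]; rewrite -ltc_itv.
have cb0 c : c \in cs -> 0 < (b (complex.Re c))%:C.
  by move=> /mapP[x /b0 bx ->]; rewrite (ltcR 0).
have ucs : uniq cs by rewrite map_inj_uniq //; exact: complexI.
have := cyclotomic_nonvanishing ucs cs2 cb0 z1.
have TE : toC (symmetrize k.+1 t) = \prod_(x <- cs) recip_quad x.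
  rewrite map_symmetrize -ofR_toR tE ofR_prod_XsubC -szxs.
  by rewrite -(size_map (real_complex R) xs) -symmetrize_prod_XsubC big_map.
have WE : 2 * (toC (symmetrize k v)).[z] =
    \sum_(x <- cs) (b (complex.Re x))%:C *
      \prod_(y <- cs | y != x) (recip_quad y).[z].
  rewrite -hornerZ -[2]/(2%:R) map_symmetrize -symmetrizeZ -ofR_toR.
  rewrite -(rmorph_nat (real_complex R)) -map_polyZ.
  rewrite -[_ *: _]addr0 vE symmetrize_sum_prod_but // horner_sum.
  by apply: eq_bigr => x _; rewrite hornerZ horner_prod.
apply: contraNneq => PE; rewrite -WE -horner_prod -TE.
move: PE; rewrite symmetrizeN !(rmorphD, rmorphM, rmorphN).
rewrite rmorph1 /= map_polyX !hornerE /= => PE.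
by rewrite -[X in _ == X](mulr0 2) -PE; apply/eqP; ring.
Qed.

(** Here e = - (2 + tau) s, so that 2 v = (2 + tau) s plus a positive
combination of the Lagrange basis for -2 and the roots of s, and - 2 P is the
expression of [salem_nonvanishing]. *)
Lemma salem_completion k (t : {poly int}) (tau : R) (ys : seq R) :
  toR t = ('X - tau%:P) * \prod_(x <- ys) ('X - x%:P) -> size ys = k ->
  uniq ys -> (forall x, x \in ys -> -2 < x < 2) -> 2 < tau ->
  exists2 v : {poly int}, (size v <= k.+1)%N &
    forall z : R[i], `|z| <= 1 ->
      (toC (symmetrize k.+1 t + ('X - 1) * symmetrize k v)).[z] != 0.
Proof.
move=> tE szys uys ys2 tau2; pose xs := -2 :: ys.
have uxs : uniq xs.
  by rewrite /= uys andbT; apply/negP => /ys2; rewrite ltxx.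
have szxs : size xs = k.+1 by rewrite /= szys.
pose s := \prod_(y <- ys) ('X - y%:P).
pose e := - (2 + tau) *: s.
have [|v [b [szv b0 vE]]] := @integral_positive_interpolation R xs e uxs.
  by rewrite (leq_trans (size_scale_leq _ _)) // size_prod_XsubC /= szys.
exists v; first by rewrite -szxs.
move=> z z1; pose cs := map (real_complex R) ys.
have csE : map (real_complex R) xs = -2 :: cs.
  by rewrite /= rmorphN /= (rmorph_nat (real_complex R)).
have cs2 c : c \in cs -> -2 < c < 2 by move=> /mapP[x /ys2 x2 ->]; rewrite -ltc_itv.
have cb0 c : c \in -2 :: cs -> 0 < (b (complex.Re c))%:C.
  by rewrite -csE => /mapP[x /b0 bx ->]; rewrite (ltcR 0).
have ucs : uniq (-2 :: cs).
  by rewrite -csE map_inj_uniq //; exact: complexI.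
have ctau2 : 2 < tau%:C.
  by rewrite -(rmorph_nat (real_complex R)) ltcR.
have := salem_nonvanishing ucs cs2 cb0 ctau2 z1.
have sE : ofR s = \prod_(x <- cs) ('X - x%:P).
  by rewrite ofR_prod_XsubC big_map.
have SE : symmetrize k (ofR s) = \prod_(x <- cs) recip_quad x.
  by rewrite sE -symmetrize_prod_XsubC size_map szys.
have TE : toC (symmetrize k.+1 t) = recip_quad tau%:C * \prod_(x <- cs) recip_quad x.
  rewrite map_symmetrize -ofR_toR tE rmorphM rmorphB /= map_polyX map_polyC sE /=.
  by have := symmetrize_prod_XsubC (tau%:C :: cs); rewrite !big_cons /= size_map szys.
have WE : 2 * (toC (symmetrize k v)).[z] =
    (2 + tau%:C) * \prod_(x <- cs) (recip_quad x).[z] +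
    \sum_(x <- -2 :: cs) (b (complex.Re x))%:C *
      \prod_(y <- -2 :: cs | y != x) (recip_quad y).[z].
  have -> : \sum_(x <- -2 :: cs) (b (complex.Re x))%:C *
      \prod_(y <- -2 :: cs | y != x) (recip_quad y).[z] =
      (symmetrize k (ofR (2 *: toR v + e))).[z].
    rewrite vE symmetrize_sum_prod_but // csE horner_sum.
    by apply: eq_bigr => x _; rewrite hornerZ horner_prod.
  rewrite rmorphD /= !map_polyZ symmetrizeD !symmetrizeZ SE ofR_toR.
  rewrite -map_symmetrize hornerD !hornerZ horner_prod.
  by rewrite !(rmorphN, rmorphD) /= rmorph1; ring.
apply: contraNneq => PE; move: WE; rewrite -horner_prod.
move: PE; rewrite !(rmorphD, rmorphM, rmorphN) rmorph1 /= map_polyX TE.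
rewrite hornerD [X in X + _]hornerM horner_recip_quad.
rewrite !(hornerD, hornerM, hornerN, hornerX, hornerC).
move: (_.[z]) (_.[z]) => S W; set B := \sum_(x <- _) _ => PE WE.
have -> : B = 2 * W - (2 + tau%:C) * S by rewrite WE; ring.
rewrite -[X in _ == X](mulr0 (-2)) -PE; apply/eqP; ring.
Qed.


Lemma uniq_real_trace_roots (t : {poly int}) (xs : seq R) :
  toR t = \prod_(x <- xs) ('X - x%:P) ->
  simple_roots (toC (symmetrize (size xs) t)) -> uniq xs.
Proof.
move=> tE simp; rewrite -(map_inj_uniq (@complexI R)).
apply: uniq_trace_roots.
by rewrite big_map size_map -(ofR_prod_XsubC xs xpredT) -tE ofR_toR -map_symmetrize.
Qed.

Lemma addr_invr_gt2 (tau : R) : 1 < tau -> 2 < tau + tau^-1.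
Proof.
move=> tau1; have tau0 : 0 < tau by apply: lt_trans tau1.
rewrite -subr_gt0.
have -> : tau + tau^-1 - 2 = (tau - 1) ^+ 2 / tau by field; rewrite gt_eqF.
by rewrite divr_gt0 // exprn_gt0 // subr_gt0.
Qed.

Lemma root_symmetrizeV (n : nat) (t : {poly R[i]}) (z : R[i]) :
  (size t <= n.+1)%N -> z != 0 -> root (symmetrize n t) z ->
  root (symmetrize n t) z^-1.
Proof.
move=> szt z0; rewrite !rootE !horner_symmetrize ?invr_eq0 // invrK.
rewrite [z^-1 + z]addrC !mulf_eq0 !expf_eq0 invr_eq0 (negPf z0) !andbF /=.
by [].
Qed.

End Real.

Theorem theorem2p7 (R : realType) (T : {poly int}) (m : nat)
    (hm : (4 <= m)%N)
    (hdeg : size T = m.+1)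
    (hsimple : simple_roots (polyZC R T))
    (hroots : forall z : R[i], root (polyZC R T) z -> z != 1 /\ z != -1)
    (hT : cyclotomic R T \/ salem R T) :
  exists P : {poly int},
    [/\ P \is monic,
        expansive (polyZC R P),
        size P = m.+1 &
        ('X + 1) * T = 'X * P + reciprocal P].
Proof.
rewrite /polyZC in hsimple hroots hT *.
have T1 : (map_poly intr T).[1 : R[i]] != 0.
  by apply/negP => /hroots[]; rewrite eqxx.
have TN1 : (map_poly intr T).[-1 : R[i]] != 0.
  by apply/negP => /hroots[_]; rewrite eqxx.
have monT : T \is monic by case: hT => -[].
have recT : is_reciprocal T.
  case: hT => [[_ unitT]|[] //]; exact: (@reciprocal_of_unit_roots R[i]).
have [d [t [mE szt mont TE]]] := trace_polynomial hdeg monT recT TN1.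
case: d => [|k] in mE szt TE; first by rewrite mE in hm.
have szt' : (size t <= k.+2)%N by rewrite szt.
have sztC : (size (map_poly (intr : int -> R[i]) t) <= k.+2)%N by rewrite size_map_intr.
have rootT x : root (map_poly intr t) x ->
    exists2 z : R[i], root (map_poly intr T) z & x = z + z^-1.
  by move=> /(root_symmetrize sztC); rewrite -map_symmetrize -TE.
have unit_itv (z : R[i]) : root (map_poly intr T) z -> `|z| = 1 -> -2 < z + z^-1 < 2.
  by move=> rz z1; have [zn1 znN1] := hroots _ rz; exact: trace_unit_circle.
suff [v szv nv] : exists2 v : {poly int}, (size v <= k.+1)%N &
    forall z : R[i], `|z| <= 1 ->
    (map_poly intr (symmetrize k.+1 t + ('X - 1) * symmetrize k v)).[z] != 0.
  have szT : size T = (k.+1).*2.+1 by rewrite hdeg mE.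
  rewrite TE in monT szT.
  have [monP szP eqP] := completion R[i] monT szT szt' szv.
  exists (T + ('X - 1) * symmetrize k v); rewrite TE mE; split=> //.
  split; first by apply/polyOverP => i; rewrite coef_map realz.
    by rewrite size_map_intr szP.
  move=> z rz; rewrite real_ltNge ?normr_real ?real1 //.
  by apply/negP => /nv; rewrite -rootE rz.
have real_itv (x : R[i]) : -2 < x < 2 -> x \is Num.real.
  by move=> /andP[/ltW/ler_real <- _]; rewrite realN realn.
have root_itv (xs : seq R) (x : R) :
    map_poly intr t = \prod_(y <- xs) ('X - y%:P) -> x \in xs ->
    root (map_poly intr t) x%:C.
  by move=> tE xxs; rewrite -ofR_toR fmorph_root tE root_prod_XsubC.
have uniq_of (xs : seq R) : size xs = k.+1 ->
    map_poly intr t = \prod_(y <- xs) ('X - y%:P) -> uniq xs.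
  by move=> szxs tE; apply: (uniq_real_trace_roots tE); rewrite szxs -TE.
case: hT => [[_ unitT]|[_ _ [tau [tau1 rtau _ tau_uniq]] _]].
- have itv (x : R[i]) : root (map_poly intr t) x -> -2 < x < 2.
    by move=> /rootT[z rz ->]; apply: unit_itv => //; exact: unitT.
  have [xs szxs tE] := real_rooted_factorization mont szt
    (fun x rx => real_itv x (itv x rx)).
  apply: (cyclotomic_completion tE szxs (uniq_of _ szxs tE)) => x xxs.
  by rewrite ltc_itv itv // (root_itv xs).
- pose tau' := tau + tau^-1.
  have tau'E : tau'%:C = tau%:C + tau%:C^-1 by rewrite rmorphD /= fmorphV.
  have tau0 : tau%:C != 0.
    by rewrite (fmorph_eq0 (real_complex R)) gt_eqF // (lt_trans _ tau1).
  (* A root of T inside the disc is the inverse of a root outside, that is,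
     of the Salem number; both have the same trace. *)
  have itv (x : R[i]) : root (map_poly intr t) x -> x = tau'%:C \/ -2 < x < 2.
    move=> /rootT[z rz ->]; rewrite tau'E.
    have z0 : z != 0.
      apply/eqP => z0; move: rz; rewrite z0 TE rootE map_symmetrize.
      by rewrite horner0_symmetrize coef_map -[k.+1]/(k.+2.-1) -szt -/(lead_coef t)
        (monicP mont) oner_eq0.
    have [zlt|zgt|z1] := real_ltgtP (normr_real z) (real1 _).
    - left; have <- : z^-1 = tau%:C.
        apply: tau_uniq; last by rewrite normfV invf_gt1 // normr_gt0.
        move: rz; rewrite /polyZC TE map_symmetrize; exact: root_symmetrizeV.
      by rewrite invrK addrC.
    - by left; rewrite (tau_uniq z).
    - by right; exact: unit_itv.
  have [|xs szxs tE] := @real_rooted_factorization R t k.+1 mont szt.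
    move=> x /itv[->|/real_itv//]; apply/complex_realP; by exists tau'.
  have uxs := uniq_of _ szxs tE.
  have tau'xs : tau' \in xs.
    rewrite -root_prod_XsubC -tE -(fmorph_root (real_complex R)) ofR_toR rootE.
    move: rtau; rewrite /polyZC TE map_symmetrize rootE horner_symmetrize // -tau'E.
    by rewrite mulf_eq0 expf_eq0 (negPf tau0) andbF.
  apply: (@salem_completion R k t tau' (rem tau' xs)).
  + by rewrite tE (perm_big _ (perm_to_rem tau'xs)) big_cons.
  + by rewrite size_rem // szxs.
  + exact: rem_uniq.
  + move=> x; rewrite mem_rem_uniq // inE => /andP[xtau' xxs].
    have [/complexI/eqP|] := itv _ (root_itv _ _ tE xxs); first by rewrite (negPf xtau').
    by rewrite ltc_itv.
  + exact: addr_invr_gt2.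
Qed.
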